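(* Let $k\in[n]$ and let $w\colon\{0,1\}^n\to\left]0,\infty\right[$ be a weight function. Then: (i) The map $f\mapsto I(f,k)$ is linear on the space of functions $\{0,1\}^n\to\mathbb{R}$. (ii) If $\pi\in S_n$ is a symmetry of $w$, then $I(\pi(f),k)=I(f,k)$ for every $f\colon\{0,1\}^n\to\mathbb{R}$. (iii) If $w$ is symmetric, then $I(f,k)=I(\mathrm{Sym}(f),k)$ for every $f\colon\{0,1\}^n\to\mathbb{R}$. (iv) If $w$ satisfies $w(\mathbf{1}-\mathbf{x})=w(\mathbf{x})$ for all $\mathbf{x}\in\{0,1\}^n$, then $I(f^d,k)=I(f,n-k+1)$ for every $f\colon\{0,1\}^n\to\mathbb{R}$. (v) For every $f\colon\{0,1\}^n\to\mathbb{R}$ we have $\sum_{j=1}^n I(f,j)=f(\mathbf{1})-f(\mathbf{0})$.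
   Context: Let $n\geqslant 1$, $[n]=\{1,\ldots,n\}$, $\mathbf{0}=(0,\ldots,0)$, $\mathbf{1}=(1,\ldots,1)$, and $|\mathbf{x}|=\sum_{i=1}^n x_i$ for $\mathbf{x}\in\{0,1\}^n$. Weight functions are assumed to be normalized so that $\sum_{\mathbf{x}\in\{0,1\}^n}w(\mathbf{x})=1$. For $f\colon\{0,1\}^n\to\mathbb{R}$ and $s\in\{0,1,\ldots,n\}$ define $\overline{f}(s)=\dfrac{\sum_{|\mathbf{x}|=s}w(\mathbf{x})f(\mathbf{x})}{\sum_{|\mathbf{x}|=s}w(\mathbf{x})}$. The influence index (depending on $w$) is $I(f,k)=\overline{f}(n-k+1)-\overline{f}(n-k)$ for $k\in[n]$. A permutation $\pi$ in the symmetric group $S_n$ on $[n]$ acts on functions by $\pi(f)(x_1,\ldots,x_n)=f(x_{\pi(1)},\ldots,x_{\pi(n)})$; $\pi$ is a symmetry of $f$ if $\pi(f)=f$; a function is symmetric if every $\pi\in S_n$ is a symmetry of it. Put $\mathrm{Sym}(f)=\frac{1}{n!}\sum_{\pi\in S_n}\pi(f)$. The dual of $f$ is $f^d(\mathbf{x})=f(\mathbf{0})+f(\mathbf{1})-f(\mathbf{1}-\mathbf{x})$. *)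

(* Defs.v *)
From mathcomp Require Import all_boot all_order all_algebra all_fingroup.
From mathcomp Require Import reals.

Set Implicit Arguments.
Unset Strict Implicit.
Unset Printing Implicit Defensive.

Import Order.TTheory GRing.Theory Num.Theory.
Local Open Scope ring_scope.

(* Coordinates are indexed by {0, ..., n-1}; [true] and [false] stand for the
   numbers 1 and 0. *)
Notation cube n := {ffun 'I_n -> bool}.

Definition zero_pt (n : nat) : cube n := [ffun=> false].
Definition one_pt (n : nat) : cube n := [ffun=> true].

(* The point 1 - x. *)
Definition complement_pt (n : nat) (x : cube n) : cube n := [ffun i => ~~ x i].

Definition hamming (n : nat) (x : cube n) : nat := (\sum_(i < n) x i)%N.

(* R^o is R seen as a module over itself; it makes the functions on the cube
   an R-module. *)
Notation pbfun R n := {ffun cube n -> R^o}.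

Section InfluenceIndex.
Context {R : realType} {n : nat}.
Implicit Types (w f : pbfun R n) (x : cube n) (p : 'S_n).

Definition weight_function w : Prop :=
  (forall x, 0 < w x) /\ \sum_x w x = 1.

(* Only meaningful for s <= n: for larger s it is 0 / 0 = 0. *)
Definition level_mean w f (s : nat) : R :=
  (\sum_(x | hamming x == s) w x * f x) / (\sum_(x | hamming x == s) w x).

(* Only meaningful for 1 <= k <= n, since subtraction on nat is truncated. *)
Definition influence w f (k : nat) : R :=
  level_mean w f (n - k + 1) - level_mean w f (n - k).

Definition permute_fun p f : pbfun R n := [ffun x : cube n => f [ffun i => x (p i)]].

Definition is_symmetry p f : Prop := permute_fun p f = f.

Definition symmetric_fun f : Prop := forall p, is_symmetry p f.

Definition symmetrize f : pbfun R n := (n`!%:R)^-1 *: \sum_(p : 'S_n) permute_fun p f.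

Definition dual_fun f : pbfun R n :=
  [ffun x : cube n => f (zero_pt n) + f (one_pt n) - f (complement_pt x)].

End InfluenceIndex.

(* Main.v *)
Require Import Defs.
From mathcomp Require Import all_boot all_order all_algebra all_fingroup.
From mathcomp Require Import reals.

Import Order.TTheory GRing.Theory Num.Theory.
Local Open Scope ring_scope.

(** The influence index is a difference of two consecutive level means, so each
    claim reduces to a property of the weighted mean over one level of the cube.

    That mean is linear in the function, which gives (i). A weight-preserving
    bijection of the cube that carries level [t] onto level [s] transports means
    from [s] to [t] ([level_mean_transport]). Permuting the coordinates fixes
    every level, which gives (ii); averaging (ii) over all permutations with the
    help of (i) gives (iii). Complementation exchanges the levels [s] and
    [n - s]; as the dual is a constant minus the complemented function, dualizing
    turns the mean at [s] into that constant minus the mean at [n - s]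
    ([level_mean_dual]). The constant cancels in the difference and the minus
    sign restores the order of the two levels, which gives (iv).

    For (v) the sum of the indices telescopes to the mean at level [n] minus the
    mean at level [0], and these two levels are the singletons of the all-ones
    and the all-zeros point. *)

Lemma hamming_permute (n : nat) (p : 'S_n) (x : cube n) :
  hamming [ffun i => x (p i)] = hamming x.
Proof.
rewrite /hamming [RHS](reindex_inj (@perm_inj _ p)) /=.
by apply: eq_bigr => i _; rewrite ffunE.
Qed.

Lemma permute_pt_inj (n : nat) (p : 'S_n) :
  injective (fun x : cube n => [ffun i => x (p i)] : cube n).
Proof.
move=> x y /ffunP exy; apply/ffunP => i.
by have := exy ((p^-1)%g i); rewrite !ffunE permKV.
Qed.

Lemma complement_ptK (n : nat) : involutive (@complement_pt n).
Proof. by move=> x; apply/ffunP => i; rewrite !ffunE negbK. Qed.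

Lemma hamming_complementD (n : nat) (x : cube n) :
  (hamming (complement_pt x) + hamming x)%N = n.
Proof.
rewrite /hamming -big_split /= -[RHS]card_ord -sum1_card.
by apply: eq_bigr => i _; rewrite ffunE; case: (x i).
Qed.

Lemma hamming_le (n : nat) (x : cube n) : (hamming x <= n)%N.
Proof. by rewrite -[leqRHS](hamming_complementD n x) leq_addl. Qed.

Lemma hamming_complement (n : nat) (x : cube n) :
  hamming (complement_pt x) = (n - hamming x)%N.
Proof.
apply: (@addIn (hamming x)).
by rewrite hamming_complementD subnK ?hamming_le.
Qed.

Lemma hamming_eq0 (n : nat) (x : cube n) :
  (hamming x == 0)%N = (x == zero_pt n).
Proof.
rewrite /hamming sum_nat_eq0; apply/forallP/eqP => [x0|-> i].
  by apply/ffunP => i; have := x0 i; rewrite ffunE; case: (x i).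
by rewrite ffunE.
Qed.

Lemma complement_zero (n : nat) : complement_pt (zero_pt n) = one_pt n.
Proof. by apply/ffunP => i; rewrite !ffunE. Qed.

Lemma hamming_eqn (n : nat) (x : cube n) :
  (hamming x == n)%N = (x == one_pt n).
Proof.
rewrite -complement_zero -(can_eq (@complement_ptK n)) complement_ptK.
by rewrite -hamming_eq0 hamming_complement subn_eq0 eqn_leq hamming_le.
Qed.

(** Levels up to [n] are inhabited, so that the denominators of the level means
    do not vanish. *)
Lemma exists_hamming (n s : nat) : (s <= n)%N -> exists x : cube n, hamming x = s.
Proof.
move=> le_sn; exists [ffun i : 'I_n => (i < s)%N].
rewrite /hamming -[RHS]card_ord -sum1_card.
rewrite [RHS](big_ord_widen n (fun=> 1%N) le_sn) [RHS]big_mkcond /=.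
by apply: eq_bigr => i _; rewrite ffunE; case: (_ < _)%N.
Qed.

Lemma level_weight_gt0 (R : realType) (n : nat) (w : pbfun R n) (s : nat) :
  (forall x, 0 < w x) -> (s <= n)%N -> 0 < \sum_(x | hamming x == s) w x.
Proof.
move=> w_gt0 /exists_hamming[x hx]; rewrite (bigD1 x) /= ?hx //.
by apply: ltr_wpDr; rewrite ?w_gt0 // sumr_ge0 // => y _; apply: ltW.
Qed.

Lemma level_mean_scalar (R : realType) (n : nat) (w : pbfun R n) (s : nat) :
  scalar (fun f : pbfun R n => level_mean w f s).
Proof.
move=> a f g; rewrite /level_mean mulrA -mulrDl mulr_sumr -big_split /=.
by congr (_ / _); apply: eq_bigr => x _; rewrite !ffunE mulrDr mulrCA.
Qed.

Lemma influence_scalar (R : realType) (n : nat) (w : pbfun R n) (k : nat) :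
  scalar (fun f : pbfun R n => influence w f k).
Proof.
by move=> a f g; rewrite /influence !level_mean_scalar mulrBr opprD addrACA.
Qed.

(** Common source of (ii) and (iv): [h] is a coordinate permutation with [t = s]
    in the former, and the complementation with [t = n - s] in the latter. *)
Lemma level_mean_transport (R : realType) (n : nat) (w f : pbfun R n)
    (h : cube n -> cube n) (s t : nat) :
    injective h -> (forall x, w (h x) = w x) ->
    (forall x, (hamming (h x) == s) = (hamming x == t)) ->
  level_mean w f s = level_mean w [ffun x => f (h x)] t.
Proof.
move=> h_inj wh hst; rewrite /level_mean; congr (_ / _); rewrite [LHS](reindex_inj h_inj) /=.
  by apply: eq_big => // x _; rewrite ffunE wh.
by apply: eq_big.
Qed.

Lemma influence_permute (R : realType) (n : nat) (w f : pbfun R n)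
    (p : 'S_n) (k : nat) :
  is_symmetry p w -> influence w (permute_fun p f) k = influence w f k.
Proof.
move=> symw.
have wp (x : cube n) : w [ffun i => x (p i)] = w x by rewrite -{2}symw ffunE.
have mean_eq s : level_mean w (permute_fun p f) s = level_mean w f s.
  apply/esym/level_mean_transport => //; first exact: permute_pt_inj.
  by move=> x; rewrite hamming_permute.
by rewrite /influence !mean_eq.
Qed.

Lemma influence_symmetrize (R : realType) (n : nat) (w f : pbfun R n) (k : nat) :
  symmetric_fun w -> influence w (symmetrize f) k = influence w f k.
Proof.
move=> symw; pose I (g : pbfun R n) : R := influence w g k.
(* By linearity the index of the average is the average of [n`!] equal terms. *)
have I_lin : scalar I by exact: influence_scalar.
have I0 : I 0 = 0.
  by have := I_lin (-1) 0 0; rewrite scaler0 addr0 mulN1r addNr.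
have ID : {morph I : g h / g + h}.
  by move=> g h; have := I_lin 1 g h; rewrite scale1r mul1r.
have IZ a g : I (a *: g) = a * I g by rewrite -[a *: g]addr0 I_lin I0 addr0.
rewrite -/(I _) /symmetrize IZ (big_morph I ID I0).
under eq_bigr => p _ do rewrite /I influence_permute //.
rewrite sumr_const (card_Sn n : #|{perm 'I_n}| = _) -[X in _ * X]mulr_natl mulKf //.
by rewrite pnatr_eq0 -lt0n fact_gt0.
Qed.

(** Transporting the means of [f] along complementation turns the claim into an
    identity between sums over the same level [s]. *)
Lemma level_mean_dual (R : realType) (n : nat) (w f : pbfun R n) (s : nat) :
    (forall x, 0 < w x) -> (forall x, w (complement_pt x) = w x) -> (s <= n)%N ->
  level_mean w (dual_fun f) s
    = f (zero_pt n) + f (one_pt n) - level_mean w f (n - s).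
Proof.
move=> w_gt0 wC le_sn.
have W_neq0 := lt0r_neq0 (level_weight_gt0 _ _ _ _ w_gt0 le_sn).
(* Applied to the mean of [f] at level [n - s]. *)
rewrite (level_mean_transport _ _ _ f (@complement_pt n) _ s) //; first last.
- move=> x; rewrite hamming_complement.
  apply/eqP/eqP => [e|->//].
  by rewrite -(subKn (hamming_le n x)) e subKn.
- exact: inv_inj (@complement_ptK n).
(* The constant is its own weighted mean over level [s]. *)
rewrite /level_mean -[X in X - _](mulfK W_neq0) -mulrBl; congr (_ / _).
rewrite mulr_sumr -sumrB; apply: eq_bigr => x _.
by rewrite !ffunE mulrBr [in RHS](mulrC (f _ + _)).
Qed.

Lemma influence_dual (R : realType) (n : nat) (w f : pbfun R n) (k : nat) :
    (forall x, 0 < w x) -> (forall x, w (complement_pt x) = w x) ->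
    (1 <= k <= n)%N ->
  influence w (dual_fun f) k = influence w f (n - k + 1).
Proof.
move=> w_gt0 wC /andP[k_gt0 le_kn].
have le_k1n : (n - k + 1 <= n)%N by rewrite addn1 ltn_subrL k_gt0 (leq_trans k_gt0).
rewrite /influence !level_mean_dual ?leq_subr // (subKn le_kn).
have -> : (n - (n - k + 1) + 1 = k)%N.
  by rewrite subnDA subKn // subnK.
by rewrite opprB addrC addrA subrK.
Qed.

Lemma level_mean_singleton (R : realType) (n : nat) (w f : pbfun R n)
    (s : nat) (y : cube n) :
    w y != 0 -> (forall x, (hamming x == s) = (x == y)) ->
  level_mean w f s = f y.
Proof.
move=> wy_neq0 hs; rewrite /level_mean !(eq_bigl _ _ hs) !big_pred1_eq.
by rewrite mulrC mulKf.
Qed.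

Lemma sum_influence (R : realType) (n : nat) (w f : pbfun R n) :
    (forall x, 0 < w x) ->
  \sum_(1 <= j < n.+1) influence w f j = f (one_pt n) - f (zero_pt n).
Proof.
move=> w_gt0; rewrite big_add1 /=.
(* The levels decrease as the index grows, hence the sign in the primitive. *)
rewrite (@telescope_sumr_eq _ 0 n (fun j => - level_mean w f (n - j))) //.
  rewrite subnn subn0 opprK addrC.
  rewrite (level_mean_singleton _ _ _ _ _ _ (lt0r_neq0 (w_gt0 _)) (hamming_eqn n)).
  by rewrite (level_mean_singleton _ _ _ _ _ _ (lt0r_neq0 (w_gt0 _)) (hamming_eq0 n)).
move=> j /andP[_ lt_jn].
by rewrite /influence addn1 subnSK // opprK addrC.
Qed.

Theorem proposition9 (R : realType) (n : nat) (hn : (1 <= n)%N)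
    (k : nat) (hk : (1 <= k <= n)%N)
    (w : pbfun R n) (hw : weight_function w) :
  [/\ scalar (fun f : pbfun R n => influence w f k),
      forall p : 'S_n, is_symmetry p w ->
        forall f : pbfun R n, influence w (permute_fun p f) k = influence w f k,
      symmetric_fun w ->
        forall f : pbfun R n, influence w f k = influence w (symmetrize f) k,
      (forall x : cube n, w (complement_pt x) = w x) ->
        forall f : pbfun R n,
          influence w (dual_fun f) k = influence w f (n - k + 1)
    & forall f : pbfun R n,
        \sum_(1 <= j < n.+1) influence w f j = f (one_pt n) - f (zero_pt n)].
Proof.
have [w_gt0 _] := hw; split.
- exact: influence_scalar.
- by move=> p symw f; apply: influence_permute.
- by move=> symw f; rewrite influence_symmetrize.
- by move=> wC f; apply: influence_dual.
- by move=> f; apply: sum_influence.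
Qed.
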